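(* Let $\mathcal A$ be a unital $C^*$-algebra with identity $1$, let $\alpha:\mathcal A\to\mathcal A$ be an endomorphism, and let $E=\alpha(1)\mathcal A$ be the $C^*$-correspondence over $\mathcal A$ with $a\cdot x=\alpha(a)x$, $x\cdot a=xa$, $\langle x,y\rangle_{\mathcal A}=x^*y$ for $x,y\in E$, $a\in\mathcal A$. There exists a left $\mathcal A$-valued inner product ${}_{\mathcal A}\langle\cdot,\cdot\rangle$ making $E$ (with its predefined left action) into a Hilbert $\mathcal A$-bimodule if and only if $(\mathcal A,\alpha)$ admits a complete transfer operator. Moreover, if $\mathcal L$ is a complete transfer operator for $(\mathcal A,\alpha)$, then $${}_{\mathcal A}\langle x,y\rangle=\mathcal L(xy^* ),\qquad \mathcal L(a)={}_{\mathcal A}\langle\alpha(1)a,\alpha(1)\rangle,\qquad x,y\in E,\ a\in\mathcal A.$$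
   Context: An endomorphism is a $*$-homomorphism $\alpha:\mathcal A\to\mathcal A$, not assumed to be unital or injective. A Hilbert $\mathcal A$-bimodule is a Banach space $E$ which is both a right Hilbert $\mathcal A$-module and a left Hilbert $\mathcal A$-module, with $\mathcal A$-valued inner products $\langle\cdot,\cdot\rangle_{\mathcal A}$ and ${}_{\mathcal A}\langle\cdot,\cdot\rangle$ satisfying the imprimitivity condition $x\cdot\langle y,z\rangle_{\mathcal A}={}_{\mathcal A}\langle x,y\rangle\cdot z$ for all $x,y,z\in E$. For an ideal $I$ of $\mathcal A$, $I^\bot=\{a\in\mathcal A: aI=0\}$. A transfer operator for $(\mathcal A,\alpha)$ is a continuous positive linear map $\mathcal L:\mathcal A\to\mathcal A$ with $\mathcal L(\alpha(a)b)=a\mathcal L(b)$ for all $a,b\in\mathcal A$; it is non-degenerate if $\alpha(\mathcal L(1))=\alpha(1)$. The system $(\mathcal A,\alpha)$ admits a complete transfer operator if $\ker\alpha$ is unital (has a multiplicative unit as an algebra, the zero ideal being counted as unital) and $\alpha(\mathcal A)$ is a hereditary subalgebra of $\mathcal A$ (equivalently $\alpha(\mathcal A)=\alpha(1)\mathcal A\alpha(1)$). In that case there is a unique non-degenerate transfer operator for $(\mathcal A,\alpha)$, namely $\mathcal L(a)=\alpha^{-1}(\alpha(1)a\alpha(1))$, $a\in \mathcal A$, where $\alpha^{-1}$ is the inverse of the isomorphism $\alpha:(\ker\alpha)^\bot\to\alpha(\mathcal A)$; it is called the complete transfer operator. *)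

(* Defs.v *)
From HB Require Import structures.
From mathcomp Require Import all_boot all_order all_algebra.
From mathcomp Require Import complex.
From mathcomp Require Import all_classical all_reals all_analysis.

Set Implicit Arguments.
Unset Strict Implicit.
Unset Printing Implicit Defensive.

Import Order.TTheory GRing.Theory Num.Theory.
Import numFieldNormedType.Exports.

Local Open Scope classical_set_scope.
Local Open Scope complex_scope.
Local Open Scope ring_scope.

(* Unital C*-algebras over the complex numbers R[i].  Norms take their values
   in R[i], as in every normedModType R[i].  The multiplication is part of the
   mixin because HB does not accept a join of the ring and normed-module
   hierarchies other than numDomainType; the ring structure is installed by the
   instance below.  The zero algebra (1 = 0) is allowed. *)
HB.mixin Record isCStarAlgebra (R : realType) A
    & CompleteNormedModule R[i] A := {
  cstar_one : A;
  cstar_mul : A -> A -> A;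
  cstar_mulA : associative cstar_mul;
  cstar_mul1l : left_id cstar_one cstar_mul;
  cstar_mul1r : right_id cstar_one cstar_mul;
  cstar_mulDl : left_distributive cstar_mul +%R;
  cstar_mulDr : right_distributive cstar_mul +%R;
  cstar_mulZl : forall (c : R[i]) (x y : A),
    cstar_mul (c *: x) y = c *: cstar_mul x y;
  cstar_mulZr : forall (c : R[i]) (x y : A),
    cstar_mul x (c *: y) = c *: cstar_mul x y;
  star : A -> A;
  starK : involutive star;
  starD : {morph star : x y / x + y};
  starZ : forall (c : R[i]) (x : A), star (c *: x) = (c^*)%R *: star x;
  cstar_starM : forall x y : A,
    star (cstar_mul x y) = cstar_mul (star y) (star x);
  cstar_normM : forall x y : A, `|cstar_mul x y| <= `|x| * `|y|;
  cstar_norm_star : forall x : A, `|cstar_mul (star x) x| = `|x| ^+ 2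
}.

#[short(type="cstarAlgType")]
HB.structure Definition CStarAlgebra (R : realType) :=
  {A of CompleteNormedModule R[i] A & isCStarAlgebra R A}.

HB.instance Definition _ (R : realType) (A : cstarAlgType R) :=
  GRing.Zmodule_isPzRing.Build A (@cstar_mulA R A) (@cstar_mul1l R A)
    (@cstar_mul1r R A) (@cstar_mulDl R A) (@cstar_mulDr R A).

Section CStarAlgebraTheory.
Variables (R : realType) (A : cstarAlgType R).
Implicit Types x y : A.

Lemma cstar_scalerAl (c : R[i]) x y : c *: (x * y) = (c *: x) * y.
Proof. by rewrite [RHS]cstar_mulZl. Qed.

Lemma cstar_scalerAr (c : R[i]) x y : c *: (x * y) = x * (c *: y).
Proof. by rewrite [RHS]cstar_mulZr. Qed.

Lemma starM x y : star (x * y) = star y * star x.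
Proof. exact: cstar_starM. Qed.

Lemma ler_cstar_normM x y : `|x * y| <= `|x| * `|y|.
Proof. exact: cstar_normM. Qed.

Lemma cstar_normE x : `|star x * x| = `|x| ^+ 2.
Proof. exact: cstar_norm_star. Qed.

End CStarAlgebraTheory.

(* *-homomorphisms, not assumed to preserve 1. *)
HB.mixin Record isStarMultiplicative (R : realType) (A B : cstarAlgType R)
    (f : A -> B) := {
  starhomM : {morph f : x y / x * y};
  starhom_star : {morph f : x / star x}
}.

HB.structure Definition StarHom (R : realType) (A B : cstarAlgType R) :=
  {f of @GRing.Linear R[i] A B *:%R f & isStarMultiplicative R A B f}.

Notation endomorphism A := (@StarHom.type _ A A).

Section CStarAlgebraNotions.
Variables (R : realType) (A : cstarAlgType R).

Definition positive (a : A) : Prop := exists b : A, a = star b * b.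

(* The order condition alone: it is meant for a subalgebra B. *)
Definition hereditary (B : set A) : Prop :=
  forall a b : A, positive a -> positive (b - a) -> B b -> B a.

Definition unital_ideal (I : set A) : Prop :=
  exists2 e : A, I e & forall a, I a -> e * a = a /\ a * e = a.

End CStarAlgebraNotions.

Section HilbertModules.
Variables (R : realType) (A : cstarAlgType R) (E : completeNormedModType R[i]).

(* Right inner products are linear in the second variable, left ones in the
   first.  The norm of the Banach space E is the one given by the inner
   product; completeness for it is part of the type of E. *)
Record right_hilbert_module (act : E -> A -> E) (ip : E -> E -> A) : Prop := {
  rmod_addl : forall x y a, act (x + y) a = act x a + act y a;
  rmod_addr : forall x a b, act x (a + b) = act x a + act x b;
  rmod_scalel : forall (c : R[i]) x a, act (c *: x) a = c *: act x a;
  rmod_scaler : forall (c : R[i]) x a, act x (c *: a) = c *: act x a;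
  rmod_mul : forall x a b, act x (a * b) = act (act x a) b;
  rip_add : forall x y z, ip x (y + z) = ip x y + ip x z;
  rip_scale : forall (c : R[i]) x y, ip x (c *: y) = c *: ip x y;
  rip_act : forall x y a, ip x (act y a) = ip x y * a;
  rip_star : forall x y, star (ip x y) = ip y x;
  rip_positive : forall x, positive (ip x x);
  rip_definite : forall x, ip x x = 0 -> x = 0;
  rip_norm : forall x, `|x| ^+ 2 = `|ip x x|
}.

Record left_hilbert_module (act : A -> E -> E) (ip : E -> E -> A) : Prop := {
  lmod_addl : forall a b x, act (a + b) x = act a x + act b x;
  lmod_addr : forall a x y, act a (x + y) = act a x + act a y;
  lmod_scalel : forall (c : R[i]) a x, act (c *: a) x = c *: act a x;
  lmod_scaler : forall (c : R[i]) a x, act a (c *: x) = c *: act a x;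
  lmod_mul : forall a b x, act (a * b) x = act a (act b x);
  lip_add : forall x y z, ip (x + y) z = ip x z + ip y z;
  lip_scale : forall (c : R[i]) x y, ip (c *: x) y = c *: ip x y;
  lip_act : forall a x y, ip (act a x) y = a * ip x y;
  lip_star : forall x y, star (ip x y) = ip y x;
  lip_positive : forall x, positive (ip x x);
  lip_definite : forall x, ip x x = 0 -> x = 0;
  lip_norm : forall x, `|x| ^+ 2 = `|ip x x|
}.

Record hilbert_bimodule (lact : A -> E -> E) (ract : E -> A -> E)
    (lip rip : E -> E -> A) : Prop := {
  bimod_left : left_hilbert_module lact lip;
  bimod_right : right_hilbert_module ract rip;
  bimod_imprimitivity : forall x y z, ract x (rip y z) = lact (lip x y) z
}.

End HilbertModules.

Section CornerModule.
Variables (R : realType) (A : cstarAlgType R) (alpha : endomorphism A).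

(* The correspondence E = alpha(1)A is the type corner; it is complete because
   alpha 1 is idempotent, so that x \in corner_set iff alpha 1 * x = x. *)
Definition corner_set : set A := [set alpha 1 * a | a in [set: A]].

Record corner := Corner { corner_val : A; _ : corner_val \in corner_set }.

HB.instance Definition _ := [isSub for corner_val].
HB.instance Definition _ := [Choice of corner by <:].

Lemma alpha1_idem : alpha 1 * alpha 1 = alpha 1.
Proof. by rewrite -starhomM mulr1. Qed.

Lemma corner_setP x : reflect (alpha 1 * x = x) (x \in corner_set).
Proof.
apply: (iffP idP) => [|h]; last by rewrite inE; exists x.
by rewrite inE => -[a _ <-]; rewrite mulrA alpha1_idem.
Qed.

Lemma corner_submod_closed : submod_closed (fun x => x \in corner_set).
Proof.
split; first by apply/corner_setP; rewrite mulr0.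
move=> c x y /corner_setP hx /corner_setP hy; apply/corner_setP.
by rewrite mulrDr -cstar_scalerAr hx hy.
Qed.

HB.instance Definition _ :=
  GRing.SubChoice_isSubLmodule.Build R[i] A _ corner corner_submod_closed.

Let corner_norm (x : corner) : R[i] := `|val x|.

Let corner_ler_normD x y :
  corner_norm (x + y) <= corner_norm x + corner_norm y.
Proof. exact: ler_normD. Qed.

Let corner_normrZ (c : R[i]) x : corner_norm (c *: x) = `|c| * corner_norm x.
Proof. exact: normrZ. Qed.

Let corner_normr0_eq0 x : corner_norm x = 0 -> x = 0.
Proof. by move=> /normr0_eq0 h; exact/val_inj. Qed.

HB.instance Definition _ := Lmodule_isNormed.Build R[i] corner
  corner_ler_normD corner_normrZ corner_normr0_eq0.

Lemma corner_normE (x : corner) : `|x| = `|val x|.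
Proof. by []. Qed.

Lemma corner_complete (F : set_system corner) :
  ProperFilter F -> cauchy F -> cvg F.
Proof.
move=> FF Fc; pose G := corner_val @ F.
have Gc : cauchy G.
  apply/cauchy_ballP => e e0; move/cauchy_ballP: Fc => /(_ e e0) [[P Q]] /=.
  move=> [FP FQ] PQ; exists (corner_val @` P, corner_val @` Q) => /=.
    split; first by apply: filterS FP => x Px; exists x.
    by apply: filterS FQ => x Qx; exists x.
  move=> [_ _] [/= [x Px <-] [y Qy <-]].
  have := PQ (x, y) (conj Px Qy); rewrite /= -!ball_normE /ball_ /=.
  by rewrite corner_normE.
have Glim : cvg G by apply: cauchy_cvg; exact: Gc.
have /fcvgrPdist_lt := Glim; set a := lim G => Ga.
have aE : alpha 1 * a = a.
  apply/eqP; rewrite -subr_eq0 -normr_eq0; apply/negPn/negP => d_neq0.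
  pose M := `|alpha 1 : A| + 1; have M0 : 0 < M by rewrite ltr_wpDl.
  have dM : 0 < `|alpha 1 * a - a| / M by rewrite divr_gt0// lt_def d_neq0 /=.
  have /filter_ex[x] : F [set x : corner |
      `|a - corner_val x| < `|alpha 1 * a - a| / M].
    exact: (Ga _ dM).
  rewrite /= ltr_pdivlMr//.
  have -> : alpha 1 * a - a =
      alpha 1 * (a - corner_val x) - (a - corner_val x).
    rewrite mulrBr (corner_setP _ (valP x)) opprB addrA; congr (_ - _).
    by rewrite subrK.
  move=> /lt_le_trans/(_ (ler_normB _ _)) /lt_le_trans.
  move=> /(_ (`|alpha 1| * `|a - corner_val x| + `|a - corner_val x|)).
  rewrite lerD2r => /(_ (ler_cstar_normM _ _)).
  by rewrite /M mulrDr mulr1 [X in X < _ + _]addrC mulrC addrC ltxx.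
have aC : a \in corner_set by exact/corner_setP.
apply/cvg_ex; exists (Corner aC); apply/fcvgrPdist_lt => e e0.
have FG : F [set x : corner | `|a - corner_val x| < e] by exact: (Ga _ e0).
by apply: filterS FG => x; rewrite /= corner_normE.
Qed.

HB.instance Definition _ := Uniform_isComplete.Build corner corner_complete.

Lemma corner_subproof a : alpha 1 * a \in corner_set.
Proof. by rewrite inE; exists a. Qed.

Lemma corner_one_subproof : alpha 1 \in corner_set.
Proof. exact/corner_setP/alpha1_idem. Qed.

Lemma corner_lact_subproof a (x : corner) : alpha a * val x \in corner_set.
Proof. by apply/corner_setP; rewrite mulrA -starhomM mul1r. Qed.

Lemma corner_ract_subproof (x : corner) a : val x * a \in corner_set.
Proof. by apply/corner_setP; rewrite mulrA (corner_setP _ (valP x)). Qed.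

Definition corner_elt (a : A) : corner := Corner (corner_subproof a).
Definition corner_one : corner := Corner corner_one_subproof.
Definition corner_lact (a : A) (x : corner) : corner :=
  Corner (corner_lact_subproof a x).
Definition corner_ract (x : corner) (a : A) : corner :=
  Corner (corner_ract_subproof x a).
Definition corner_rip (x y : corner) : A := star (val x) * val y.

End CornerModule.

Section TransferOperators.
Variables (R : realType) (A : cstarAlgType R) (alpha : endomorphism A).

Record transfer_operator (L : {linear A -> A}) : Prop := {
  transfer_continuous : continuous L;
  transfer_positive : forall a, positive a -> positive (L a);
  transfer_mul : forall a b, L (alpha a * b) = a * L b
}.

Definition nondegenerate (L : {linear A -> A}) : Prop :=
  alpha (L 1) = alpha 1.

Definition admits_complete_transfer_operator : Prop :=
  unital_ideal [set a | alpha a = 0] /\ hereditary (range alpha).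

(* When the system admits a complete transfer operator, the complete one is its
   unique non-degenerate transfer operator; it is then given by
   L a = alpha^-1 (alpha 1 * a * alpha 1), where alpha^-1 is the inverse of the
   restriction of alpha to the annihilator of its kernel. *)
Record complete_transfer_operator (L : {linear A -> A}) : Prop := {
  complete_admits : admits_complete_transfer_operator;
  complete_transfer : transfer_operator L;
  complete_nondegenerate : nondegenerate L
}.

End TransferOperators.

(* Main.v *)
(* Write [p = alpha 1].  For a left inner product on [E = p A], imprimitivity
   applied to [p] reads [alpha (lip x y) = x y^*]; hence [alpha(A) = p A p] and
   [1 - lip p p] is the unit of [ker alpha].  Conversely, polarization shows
   that a hereditary range is [p A p], and the preimage of [x y^*] in the
   annihilator of the kernel is the left inner product.

   Heredity of [p A p], positivity of that inner product and its norm rest on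
   the order structure of a C*-algebra, obtained without spectral theory: an
   [h = h^*] with [|1 - h| <= 1] is a square in its bicommutant, by a convergent
   iteration; the norm description of the cone makes it closed under sums; and
   commuting self-adjoint [b], [c] satisfy [|b|^2 <= |b^2 + c^2|], because
   [b + i c] is normal. *)

Require Import Defs.
From mathcomp Require Import all_boot all_order all_algebra.
From mathcomp Require Import complex.
From mathcomp Require Import all_classical all_reals all_analysis.
From mathcomp Require Import ring lra.

Set Implicit Arguments.
Unset Strict Implicit.
Unset Printing Implicit Defensive.

Import Order.TTheory GRing.Theory Num.Theory.
Import numFieldNormedType.Exports.

Local Open Scope ring_scope.

(** * Elementary identities and norm estimates in a C*-algebra *)

Section CStarBasics.
Variables (R : realType) (A : cstarAlgType R).
Implicit Types (x y z h s e : A) (c t : R[i]).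

Lemma star_lin c x y : star (c *: x + y) = c^* *: star x + star y.
Proof. by rewrite starD starZ. Qed.

Lemma star0 : star (0 : A) = 0.
Proof. by have /(canLR (addrK _)) := starD (0 : A) 0; rewrite addr0 subrr. Qed.

Lemma starN x : star (- x) = - star x.
Proof. by apply/eqP; rewrite -addr_eq0 -starD addNr star0. Qed.

Lemma starB x y : star (x - y) = star x - star y.
Proof. by rewrite starD starN. Qed.

Lemma star1 : star (1 : A) = 1.
Proof.
by rewrite -[RHS](@starK R A) -[in RHS](mul1r (star 1)) starM starK mul1r.
Qed.

Lemma starZ_ge0 t x : 0 <= t -> star (t *: x) = t *: star x.
Proof. by move=> t0; rewrite starZ geC0_conj. Qed.

Lemma star_mull x : star (star x * x) = star x * x.
Proof. by rewrite starM starK. Qed.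

Lemma norm_star x : `|star x| = `|x|.
Proof.
have le z : `|z| <= `|star z|.
  have [->|z0] := eqVneq z 0; first by rewrite normr0.
  rewrite -(ler_pM2r (x := `|z|)) ?normr_gt0//.
  by rewrite -expr2 -cstar_normE ler_cstar_normM.
by apply/le_anti; rewrite le -{2}(@starK R A x) le.
Qed.

Lemma norm_mul_star x : `|x * star x| = `|x| ^+ 2.
Proof. by rewrite -{1}(@starK R A x) cstar_normE norm_star. Qed.

Lemma norm_proj e : star e = e -> e * e = e -> `|e| <= 1.
Proof.
move=> es ee; have [->|e0] := eqVneq e 0; first by rewrite normr0 ler01.
have /eqP : `|e| = `|e| ^+ 2 by rewrite -cstar_normE es ee.
rewrite -subr_eq0 -{1}[`|e|]mulr1 -mulrBr mulf_eq0 normr_eq0 (negPf e0) /=.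
by rewrite subr_eq0 => /eqP <-.
Qed.

Lemma norm_cstar1 : `|1 : A| <= 1.
Proof. by apply: norm_proj; rewrite ?star1 ?mulr1. Qed.

Lemma cstar_eq0 x : star x * x = 0 -> x = 0.
Proof.
move=> xx; apply: normr0_eq0; apply/eqP.
by have /esym/eqP := cstar_normE x; rewrite xx normr0 sqrf_eq0.
Qed.

Lemma sa_sqr_eq0 h : star h = h -> h * h = 0 -> h = 0.
Proof. by move=> hs hh; apply: cstar_eq0; rewrite hs. Qed.

Lemma cartesian_sqr b s : star b = b -> star s = s -> b * s = s * b ->
  star (b + 'i *: s) * (b + 'i *: s) = b * b + s * s.
Proof.
move=> bs ss bC; rewrite starD starZ conjCi bs ss mulrDl !mulrDr.
rewrite -!cstar_scalerAl -!cstar_scalerAr scalerA mulNr.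
rewrite -[_ * 'i]expr2 sqrCi opprK.
by rewrite scale1r bC scaleNr addrA addrK.
Qed.

(** [b] is the real part of [u = b + i s], so [|b| <= |u|], and the C*-identity turns [|u| ^+ 2]
    into the norm of the sum of squares. *)
Lemma cartesian_norm b s : star b = b -> star s = s -> b * s = s * b ->
  `|b| ^+ 2 <= `|b * b + s * s|.
Proof.
move=> bs ss bC; set u := b + 'i *: s.
have uE : `|b * b + s * s| = `|u| ^+ 2 by rewrite -cartesian_sqr// cstar_normE.
have bE : b = 2^-1 *: (u + star u).
  rewrite starD starZ conjCi bs ss addrACA scaleNr subrr addr0 -mulr2n.
  by rewrite -[b *+ 2]scaler_nat scalerA mulVf ?pnatr_eq0// scale1r.
rewrite uE ler_pXn2r ?nnegrE// {1}bE normrZ ger0_norm ?invr_ge0// mulrC.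
rewrite ler_pdivrMr// mulrDr mulr1 (le_trans (ler_normD _ _))//.
by rewrite norm_star.
Qed.

Lemma sum_sqr_eq0 b s : star b = b -> star s = s -> b * s = s * b ->
  b * b + s * s = 0 -> b = 0.
Proof.
move=> bs ss bC bs0.
have /cstar_eq0 u0 : star (b + 'i *: s) * (b + 'i *: s) = 0.
  by rewrite cartesian_sqr.
have : star (b + 'i *: s) + (b + 'i *: s) = 0 by rewrite u0 star0 addr0.
rewrite starD starZ conjCi bs ss addrACA scaleNr addNr addr0 -mulr2n.
by move=> /eqP; rewrite -[b *+ 2]scaler_nat scaler_eq0 pnatr_eq0 => /eqP.
Qed.

End CStarBasics.

(** * A scalar sequence controlling the square-root iteration *)

Section ScalarMajorant.
Variable R : realType.

(* The iteration [sqrt_iter] below at the scalar [k = 1]; it dominates the one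
   of any [k] in the unit ball. *)
Fixpoint majorant (n : nat) : R :=
  if n is m.+1 then (1 + majorant m ^+ 2) / 2 else 0.

Lemma majorantS n : majorant n.+1 = (1 + majorant n ^+ 2) / 2.
Proof. by []. Qed.
Arguments majorant : simpl never.

Lemma majorant_itv n : 0 <= majorant n <= 1.
Proof.
elim: n => [|n /andP[t0 t1]]; first by rewrite lexx ler01.
by rewrite majorantS; nra.
Qed.

Lemma majorant_nondecreasing : nondecreasing_seq majorant.
Proof.
apply/nondecreasing_seqP => n; rewrite majorantS.
have /andP[t0 t1] := majorant_itv n; nra.
Qed.

Lemma majorant_cauchy (e : R) : 0 < e ->
  exists N, forall n, (N <= n)%N -> majorant n - majorant N < e.
Proof.
move=> e0.
have hcvg : cvgn majorant.
  apply: nondecreasing_is_cvgn; first exact: majorant_nondecreasing.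
  by exists 1 => _ [n _ <-]; have /andP[] := majorant_itv n.
have ub n : majorant n <= limn majorant.
  exact: nondecreasing_cvgn_le majorant_nondecreasing hcvg n.
have /cvgrPdist_lt/(_ _ e0)[N _ /(_ N (leqnn N))] := hcvg => /= hN.
exists N => n _; apply: le_lt_trans hN.
by rewrite (le_trans _ (ler_norm _))// lerD2r.
Qed.

End ScalarMajorant.
Arguments majorant : simpl never.

(** * Square roots of self-adjoint elements in the unit ball about [1] *)

Section SquareRoot.
Variables (R : realType) (A : cstarAlgType R).
Implicit Types (x h : A).

Section Iteration.
Variable k : A.
Hypotheses (ks : star k = k) (k1 : `|k| <= 1).

(** A limit [l] satisfies [2 l = k + l^2], that is, [1 - l] is a square root of [1 - k]. *)
Fixpoint sqrt_iter (n : nat) : A :=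
  if n is m.+1 then 2^-1 *: (k + sqrt_iter m * sqrt_iter m) else 0.

Lemma sqrt_iter_star n : star (sqrt_iter n) = sqrt_iter n.
Proof.
elim: n => [|n IH] /=; first exact: star0.
by rewrite starZ_ge0 ?invr_ge0// starD starM IH ks.
Qed.

Lemma sqrt_iter_comm x n : x * k = k * x -> x * sqrt_iter n = sqrt_iter n * x.
Proof.
move=> xk; elim: n => [|n IH] /=; first by rewrite mulr0 mul0r.
rewrite -cstar_scalerAr -cstar_scalerAl mulrDr mulrDl xk.
by rewrite mulrA IH -mulrA IH mulrA.
Qed.

Lemma sqrt_iter_norm n : `|sqrt_iter n| <= (majorant R n)%:C%C.
Proof.
elim: n => [|n IH] /=; first by rewrite normr0 lexx.
rewrite majorantS normrZ ger0_norm ?invr_ge0// rmorphM/= rmorphD/=.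
rewrite rmorphXn/= rmorph1.
rewrite fmorphV/= rmorph_nat mulrC ler_pM2r ?invr_gt0//.
rewrite (le_trans (ler_normD _ _))// lerD//.
by rewrite (le_trans (ler_cstar_normM _ _))// expr2 ler_pM.
Qed.

(** Induction on [a^2 - b^2 = a (a - b) + (a - b) b] for consecutive iterates; the scalar increments
    factor in the same way. *)
Lemma sqrt_iter_step n : `|sqrt_iter n.+1 - sqrt_iter n| <=
  (majorant R n.+1 - majorant R n)%:C%C.
Proof.
elim: n => [|n IH].
  rewrite majorantS /= !mulr0 addr0 !subr0 [majorant R 0]/majorant expr0n.
  rewrite addr0 normrZ ger0_norm ?invr_ge0//.
  by rewrite mul1r fmorphV/= rmorph_nat ler_piMr// invr_ge0.
set a := sqrt_iter n.+1 in IH *; set b := sqrt_iter n in IH *.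
have -> : sqrt_iter n.+2 - a = 2^-1 *: (a * (a - b) + (a - b) * b).
  rewrite [sqrt_iter n.+2]/= -/a {2}/a /= -/b -scalerBr; congr (_ *: _).
  by rewrite mulrBr mulrBl addrA subrK opprD addrACA subrr add0r.
have -> : majorant R n.+2 - majorant R n.+1 =
  2^-1 * ((majorant R n.+1 + majorant R n) * (majorant R n.+1 - majorant R n)).
  by rewrite (majorantS R n.+1) [in X in _ - X = _]majorantS; field.
rewrite normrZ ger0_norm ?invr_ge0// rmorphM fmorphV/= rmorph_nat.
rewrite ler_pM2l ?invr_gt0// (le_trans (ler_normD _ _))// [in leRHS]mulrDl.
rewrite rmorphD/=.
apply: lerD; rewrite (le_trans (ler_cstar_normM _ _))//.
  by rewrite rmorphM ler_pM//; exact: sqrt_iter_norm.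
by rewrite mulrC rmorphM ler_pM//; exact: sqrt_iter_norm.
Qed.

Lemma sqrt_iter_dist n m : (n <= m)%N ->
  `|sqrt_iter m - sqrt_iter n| <= (majorant R m - majorant R n)%:C%C.
Proof.
move=> /subnK <-; elim: (m - n)%N => [|d IH]; first by rewrite !subrr normr0.
rewrite addSn -(subrKA (sqrt_iter (d + n))).
rewrite -(subrKA (majorant R (d + n)) (majorant R (d + n).+1)) raddfD.
by rewrite (le_trans (ler_normD _ _))// lerD// sqrt_iter_step.
Qed.

Lemma sqrt_iter_cvg : exists l : A,
  forall e : R[i], 0 < e -> exists N, forall n, (N <= n)%N ->
    `|l - sqrt_iter n| < e.
Proof.
have small (e : R[i]) : 0 < e -> exists N, forall n, (N <= n)%N ->
    `|sqrt_iter n - sqrt_iter N| < e.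
  (* Norms live in [R[i]], but a positive [e] is real, so the real Cauchy estimate applies to its
     real part. *)
  move=> e0; have eE : (complex.Re e)%:C%C = e by rewrite RRe_real// gtr0_real.
  have [N hN] : exists N, forall n, (N <= n)%N ->
      majorant R n - majorant R N < complex.Re e.
    by apply: majorant_cauchy; rewrite -ltcR eE.
  exists N => n Nn; rewrite (le_lt_trans (sqrt_iter_dist Nn))// -eE ltcR.
  exact: hN.
have hc : cvgn sqrt_iter.
  apply: cauchy_cvg; apply: cauchy_exP => e e0.
  have [N hN] := small _ e0; exists (sqrt_iter N).
  exists N => // n /= Nn; rewrite -ball_normE /ball_/= distrC; exact: hN.
exists (limn sqrt_iter) => e e0.
have /cvgrPdist_lt/(_ _ e0)[N _ hN] := hc.
by exists N => n Nn; exact: hN.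
Qed.

End Iteration.

(* The commutation clause places the root in the bicommutant of [h]; the norm
   bound makes the root itself of the same shape, hence positive. *)
Lemma sqrt_ball h : star h = h -> `|1 - h| <= 1 ->
  exists s, [/\ star s = s, s * s = h, `|1 - s| <= 1
              & forall x, x * h = h * x -> x * s = s * x].
Proof.
move=> hs h1; pose k := 1 - h; pose u := sqrt_iter k.
have ks : star k = k by rewrite starB star1 hs.
have [l] := sqrt_iter_cvg h1; rewrite -/k -/u => hl.
have u1 n : `|u n| <= 1.
  rewrite (le_trans (sqrt_iter_norm h1 n))// (lecR _ 1).
  by have /andP[] := majorant_itv R n.
(* An element bounded by [C] times the approximation error is zero; every property of [l] given by
   an equation passes to the limit this way. Two consecutive errors are allowed because the
   recursion links [u n] to [u n.+1]. *)
have lim0 (v : A) (C : R[i]) : 0 < C -> (forall n (e : R[i]),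
    `|l - u n| <= e -> `|l - u n.+1| <= e ->
    `|v| <= C * e) -> v = 0.
  move=> C0 hv; apply/eqP/negPn/negP => v0.
  have [|N hN] := hl (`|v| / C / 2); first by rewrite !divr_gt0// normr_gt0.
  have /hv := ltW (hN N (leqnn N)) => /(_ (ltW (hN _ (leqnSn N)))).
  rewrite mulrA mulrCA divff ?gt_eqF// mulr1 ler_pdivlMr// mulrDr mulr1.
  by rewrite gerDl normr_le0 (negPf v0).
have ls : star l = l.
  apply/eqP; rewrite -subr_eq0; apply/eqP; apply: (lim0 _ 2) => // n e ne _.
  have -> : star l - l = star (l - u n) - (l - u n).
    by rewrite starB sqrt_iter_star// opprB addrA subrK.
  by rewrite (le_trans (ler_normB _ _))// norm_star mulr_natl mulr2n lerD.
have l1 : `|l| <= 1.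
  case: (real_leP (normr_real l) (real1 _)) => // l1.
  have [|N /(_ N (leqnn N))] := hl (`|l| - 1); first by rewrite subr_gt0.
  move=> /lt_geF/negbT/negP[].
  by rewrite lerBlDr -{1}(subrK (u N) l) (le_trans (ler_normD _ _))// lerD2l.
have lC x : x * h = h * x -> x * l = l * x.
  move=> xh; apply/eqP; rewrite -subr_eq0; apply/eqP.
  apply: (lim0 _ (2 * (`|x| + 1))) => [|n e ne _].
    by rewrite mulr_gt0// ltr_wpDl.
  have -> : x * l - l * x = x * (l - u n) - (l - u n) * x.
    rewrite mulrBr mulrBl sqrt_iter_comm ?opprB ?addrA ?subrK//.
    by rewrite mulrBr mulrBl mulr1 mul1r xh.
  have e0 : 0 <= e := le_trans (normr_ge0 _) ne.
  have -> : 2 * (`|x| + 1) * e = `|x| * e + e * `|x| + 2 * e by ring.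
  rewrite (le_trans (ler_normB _ _))// ler_wpDr ?mulr_ge0// lerD//.
    by rewrite (le_trans (ler_cstar_normM _ _))// ler_wpM2l.
  by rewrite (le_trans (ler_cstar_normM _ _))// ler_wpM2r.
have lE : l = 2^-1 *: (k + l * l).
  apply/eqP; rewrite -subr_eq0; apply/eqP.
  apply: (lim0 _ (2 + `|l|)) => [|n e ne nSe]; first by rewrite ltr_pwDl.
  have -> : l - 2^-1 *: (k + l * l) =
      (l - u n.+1) - 2^-1 *: (u n * (l - u n) + (l - u n) * l).
    have -> : u n * (l - u n) + (l - u n) * l = l * l - u n * u n.
      by rewrite mulrBr mulrBl addrC addrA subrK.
    rewrite -[RHS]addrA -[in RHS]opprD -[in RHS]scalerDr.
    by rewrite [in RHS]addrACA subrr addr0.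
  have e0 : 0 <= e := le_trans (normr_ge0 _) ne.
  have -> : (2 + `|l|) * e = e + (1 * e + e * `|l|) by ring.
  rewrite (le_trans (ler_normB _ _))// lerD// normrZ ger0_norm ?invr_ge0//.
  rewrite (@le_trans _ _ `|u n * (l - u n) + (l - u n) * l|)//.
    by rewrite ler_piMl// invf_le1// ler1n.
  rewrite (le_trans (ler_normD _ _))// lerD//.
    by rewrite (le_trans (ler_cstar_normM _ _))// ler_pM.
  by rewrite (le_trans (ler_cstar_normM _ _))// ler_wpM2r.
exists (1 - l); split.
- by rewrite starB star1 ls.
- have /(congr1 (fun x => 2 *: x)) := lE.
  rewrite scalerA mulfV ?pnatr_eq0// scale1r scaler_nat => l2.
  rewrite mulrBl mul1r mulrBr mulr1 opprB addrACA -opprD -mulr2n l2.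
  by rewrite opprD addrACA subrr addr0 /k opprB addrC subrK.
- by rewrite opprB addrC subrK.
- by move=> x xh; rewrite mulrBr mulrBl mulr1 mul1r lC.
Qed.
End SquareRoot.

(** * The positive cone and the positivity of [star x * x] *)

Section Positivity.
Variables (R : realType) (A : cstarAlgType R).
Implicit Types (x y h s : A) (c t : R[i]).

(* A norm description of the positive cone: it makes stability under sums
   immediate, whereas with [positive] it is the hard part of the theory. *)
Definition nneg h :=
  star h = h /\ exists2 t : R[i], 0 < t & `|t *: (1 : A) - h| <= t.

(** [t^-1 *: h] lies in the unit ball about [1]; its root is rescaled by [sqrtC t]. *)
Lemma nneg_sqrt h : nneg h -> exists s,
  [/\ star s = s, s * s = h, nneg s & forall x, x * h = h * x -> x * s = s * x].
Proof.
move=> [hs [t t0 ht]].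
have r0 : 0 < sqrtC t by rewrite sqrtC_gt0.
have [||s [ss sE s1 sC]] := @sqrt_ball R A (t^-1 *: h).
- by rewrite starZ_ge0 ?invr_ge0 ?ltW// hs.
- have -> : 1 - t^-1 *: h = t^-1 *: (t *: (1 : A) - h).
    by rewrite scalerBr scalerA mulVf ?gt_eqF// scale1r.
  by rewrite normrZ ger0_norm ?invr_ge0 ?(ltW t0)// mulrC ler_pdivrMr// mul1r.
exists (sqrtC t *: s); split.
- by rewrite starZ_ge0 ?ltW// ss.
- rewrite -cstar_scalerAl -cstar_scalerAr scalerA -expr2 sqrtCK sE scalerA.
  by rewrite mulfV ?gt_eqF// scale1r.
- split; first by rewrite starZ_ge0 ?ltW// ss.
  exists (sqrtC t) => //.
  by rewrite -scalerBr normrZ ger0_norm ?(ltW r0)// ler_piMr// ltW.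
- move=> x xh; rewrite -cstar_scalerAl -cstar_scalerAr sC//.
  by rewrite -cstar_scalerAl -cstar_scalerAr xh.
Qed.

(** With [h] scaled to [k] in the unit ball, [1 - k^2] has a self-adjoint root [s] commuting with
    [k], and [s^2 + k^2 = 1] forces [|s| <= 1]. *)
Lemma nneg_sqr h : star h = h -> nneg (h * h).
Proof.
move=> hs; split; first by rewrite starM hs.
pose r := `|h| + 1; have r0 : 0 < r by rewrite ltr_wpDl.
exists (r ^+ 2); first by rewrite exprn_gt0.
pose k := r^-1 *: h.
have ks : star k = k by rewrite starZ_ge0 ?invr_ge0 ?(ltW r0)// hs.
have k1 : `|k| <= 1.
  rewrite normrZ ger0_norm ?invr_ge0 ?(ltW r0)// mulrC ler_pdivrMr// mul1r.
  by rewrite lerDl.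
have hE : h * h = r ^+ 2 *: (k * k).
  rewrite /k -cstar_scalerAl -cstar_scalerAr !scalerA expr2.
  by rewrite -invfM mulfV ?scale1r// mulf_neq0 ?gt_eqF.
have [||s [ss sE _ sC]] := @sqrt_ball R A (1 - k * k).
- by rewrite starB star1 starM ks.
- rewrite opprB addrC subrK (le_trans (ler_cstar_normM _ _))//.
  by rewrite mulr_ile1.
have s1 : `|s| <= 1.
  have sk : s * k = k * s.
    by rewrite sC// mulrBr mulrBl mulr1 mul1r mulrA.
  rewrite -(@ler_pXn2r _ 2) ?nnegrE// expr1n.
  rewrite (le_trans (cartesian_norm ss ks sk))//.
  by rewrite sE subrK norm_cstar1.
rewrite hE -scalerBr -sE normrZ ger0_norm ?exprn_ge0 ?(ltW r0)//.
rewrite ler_piMr ?exprn_ge0 ?(ltW r0)// (le_trans (ler_cstar_normM _ _))//.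
by rewrite mulr_ile1.
Qed.

Lemma nnegD x y : nneg x -> nneg y -> nneg (x + y).
Proof.
move=> [xs [t t0 xt]] [ys [u u0 yu]]; split; first by rewrite starD xs ys.
exists (t + u); first exact: addr_gt0.
by rewrite scalerDl opprD addrACA (le_trans (ler_normD _ _))// lerD.
Qed.

Lemma nnegZ c x : 0 < c -> nneg x -> nneg (c *: x).
Proof.
move=> c0 [xs [t t0 xt]]; split; first by rewrite starZ_ge0 ?ltW// xs.
exists (c * t); first exact: mulr_gt0.
by rewrite -scalerA -scalerBr normrZ ger0_norm ?(ltW c0)// ler_pM2l.
Qed.

(** Roots [s] of [h] and [r] of [- h] commute by the bicommutant clause, and [s^2 + r^2 = 0]. *)
Lemma nneg_anti h : nneg h -> nneg (- h) -> h = 0.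
Proof.
move=> /nneg_sqrt[s [ss sE _ sC]] /nneg_sqrt[r [rs rE _ rC]].
have rs_comm : r * s = s * r.
  by apply: sC; rewrite -[h]opprK -rE mulrN mulNr mulrA.
have /(sum_sqr_eq0 ss rs (esym rs_comm)) s0 : s * s + r * r = 0.
  by rewrite sE rE subrr.
by rewrite -sE s0 mul0r.
Qed.

(** Up to sign, [a] and [b] are twice the real and imaginary parts of [y]; the sum is half of
    [a^2 + b^2]. *)
Lemma nneg_mul_starD y : nneg (star y * y + y * star y).
Proof.
pose a := y + star y; pose b := 'i *: (y - star y).
have aS : star a = a by rewrite starD starK addrC.
have bS : star b = b.
  by rewrite starZ conjCi starB starK scaleNr -scalerN opprB.
have E : star y * y + y * star y = 2^-1 *: (a * a + b * b).
  rewrite -[b * b]cstar_scalerAl -cstar_scalerAr scalerA -[_ * 'i]expr2 sqrCi.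
  have sqrDE (u v : A) : (u + v) * (u + v) = u * u + v * v + (u * v + v * u).
    by rewrite mulrDl !mulrDr [v * u + _]addrC addrACA.
  rewrite scaleN1r !sqrDE mulrNN mulrN mulNr -opprD opprB.
  rewrite [X in 2^-1 *: X]addrC addrA subrK.
  rewrite -mulr2n -[(_ + _) *+ 2]scaler_nat scalerA mulVf ?pnatr_eq0// scale1r.
  by rewrite addrC.
rewrite E; apply: nnegZ; first by rewrite invr_gt0.
by apply: nnegD; apply: nneg_sqr.
Qed.

(* Otherwise [y * star y] would be a square [g * g], and for [z = f * star y]
   both [star z * z = - g^4] and [z * star z = - f^4] would be negative. *)
Lemma star_mul_eqN_sqr y f : star f = f -> star y * y = - (f * f) -> y = 0.
Proof.
move=> fs yf.
(* [y * star y] is the sum of [star y * y + y * star y] and [f * f]. *)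
have /nneg_sqrt[g [gs gE _ _]] : nneg (y * star y).
  have := nnegD (nneg_mul_starD y) (nneg_sqr fs).
  by rewrite yf addrC addrA subrr add0r.
have ggs : star (g * g) = g * g by rewrite starM gs.
have ffs : star (f * f) = f * f by rewrite starM fs.
have := nneg_mul_starD (f * star y); rewrite starM starK fs.
have -> : y * f * (f * star y) = - (g * g * (g * g)).
  by rewrite gE mulrA -[y * f * f]mulrA -[f * f]opprK -yf mulrN mulNr !mulrA.
have -> : f * star y * (y * f) = - (f * f * (f * f)).
  by rewrite mulrA -[f * star y * y]mulrA yf mulrN mulNr !mulrA.
move=> /(nnegD (nneg_sqr ggs)); rewrite addrA subrr add0r.
move=> /(nneg_anti (nneg_sqr ffs)) /(sa_sqr_eq0 ffs) ff0.
by apply: cstar_eq0; rewrite yf ff0 oppr0.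
Qed.

(* Kelley-Vaught: with [a] the modulus of [h = star x * x], the element
   [y = x * (a - h)] satisfies [star y * y = - (a - h) * a * (a - h)]. *)
Lemma nneg_star_mul x : nneg (star x * x).
Proof.
set h := star x * x; have hs : star h = h by exact: star_mull.
have [a [as_ aE a_nneg aC]] := nneg_sqrt (nneg_sqr hs).
(* A root [q] of [a] turns [n * a * n] into the square of the self-adjoint [q * n], as
   [star_mul_eqN_sqr] requires. *)
have [q [qs qE _ qC]] := nneg_sqrt a_nneg.
have ha : h * a = a * h by rewrite aC// mulrA.
pose n := a - h.
have ns : star n = n by rewrite starB as_ hs.
have nq : n * q = q * n.
  by rewrite qC// /n mulrBl mulrBr ha.
have qns : star (q * n) = q * n by rewrite starM qs ns.
have an : a * n = - (h * n) by rewrite /n !mulrBr aE ha opprB.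
have y0 : x * n = 0.
  apply: (star_mul_eqN_sqr qns); rewrite starM ns mulrA -[n * star x * x]mulrA.
  by rewrite -/h -mulrA -[h * n]opprK -an -qE mulrN !mulrA nq.
have hn : h * n = 0 by rewrite /h -mulrA y0 mulr0.
(* [a * n = - (h * n) = 0] gives [n * n = 0], so [h] equals its modulus [a]. *)
have /(sa_sqr_eq0 ns)/eqP : n * n = 0.
  by rewrite {1}/n mulrBl an hn oppr0 addr0.
by rewrite subr_eq0 => /eqP <-.
Qed.

(** A root of this element, paired with [b] in [cartesian_norm], yields both norm comparisons for
    [alpha]. The case [b = 0] is separate because [nneg] asks for a positive radius. *)
Lemma nneg_norm_sub_sqr b : star b = b -> nneg (`|b| ^+ 2 *: (1 : A) - b * b).
Proof.
move=> bs; have [->|b0] := eqVneq b 0.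
  rewrite normr0 expr0n scale0r sub0r mulr0 oppr0 -(mulr0 0).
  exact/nneg_sqr/star0.
split; first by rewrite starB starZ_ge0 ?exprn_ge0// star1 starM bs.
exists (`|b| ^+ 2); first by rewrite exprn_gt0// normr_gt0.
by rewrite opprB addrC subrK -{1}bs cstar_normE.
Qed.

Lemma star_mulD_eq0 x y : star x * x + star y * y = 0 -> x = 0.
Proof.
move=> /eqP; rewrite addr_eq0 => /eqP xy; apply: cstar_eq0; apply: nneg_anti.
  exact: nneg_star_mul.
by rewrite xy opprK; exact: nneg_star_mul.
Qed.

End Positivity.

(** * Polarization in a corner *)

Section Polarization.
Variables (R : realType) (A : cstarAlgType R).
Implicit Types (x y z s e : A).

(** The corner [e A e] is spanned by its elements [star s * s]. It serves with [e = 1] for adjoints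
    and with [e = alpha 1] for heredity. *)
Lemma polarization_ind e (Q : A -> Prop) : star e = e -> e * e = e ->
  (forall (c : R[i]) x y, Q x -> Q y -> Q (c *: x + y)) ->
  (forall s, e * s = s -> s * e = s -> Q (star s * s)) ->
  forall z, e * z = z -> z * e = z -> Q z.
Proof.
move=> es ee Qlin Qsqr z ez ze.
have Q0 : Q 0.
  by rewrite -[0](mulr0 (star 0)); apply: Qsqr; rewrite ?mulr0 ?mul0r.
have QZ (c : R[i]) x : Q x -> Q (c *: x).
  by move=> Qx; rewrite -[_ *: _]addr0; exact: Qlin.
have zs : star z * e = star z by rewrite -es -starM ez.
have sz : e * star z = star z by rewrite -es -starM ze.
(* For [u = c *: z], the squares built from [e + u] and [e - u] differ by [2 (u + star u)]. *)
have Qre (c : R[i]) : Q (c *: z + c^* *: star z).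
  pose u := c *: z.
  have ue : u * e = u by rewrite /u -cstar_scalerAl ze.
  have eu : e * u = u by rewrite /u -cstar_scalerAr ez.
  have us : star u = c^* *: star z by rewrite starZ.
  have use : star u * e = star u by rewrite us -cstar_scalerAl zs.
  have E v : e * v = v -> star v * e = star v ->
      star (e + v) * (e + v) = (v + star v) + (e + star v * v).
    move=> ev ve; rewrite starD es mulrDl !mulrDr ee ev ve.
    by rewrite [e + v]addrC addrACA.
  have EN : star (e - u) * (e - u) = - (u + star u) + (e + star u * u).
    by rewrite E ?mulrN ?eu ?starN ?mulNr ?use// opprK opprD.
  have -> : u + c^* *: star z = 2^-1 *:
      ((-1) *: (star (e - u) * (e - u)) + star (e + u) * (e + u)).
    have D (m w : A) : (-1) *: (- m + w) + (m + w) = m + m.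
      by rewrite scaleN1r opprD opprK addrACA addNr addr0.
    rewrite EN E// D -us.
    rewrite -mulr2n -[(_ + _) *+ 2]scaler_nat.
    by rewrite scalerA mulVf ?pnatr_eq0// scale1r.
  apply: QZ; apply: Qlin; apply: Qsqr.
  - by rewrite mulrBr ee eu.
  - by rewrite mulrBl ee ue.
  - by rewrite mulrDr ee eu.
  - by rewrite mulrDl ee ue.
(* The values [c = i] and [c = 1] yield [z - star z] and [z + star z]. *)
have -> : z = 2^-1 *: ((- 'i) *: ('i *: z + ('i)^* *: star z) +
                       (1 *: z + 1^* *: star z)).
  have -> : (- 'i) *: ('i *: z + ('i)^* *: star z) = z - star z.
    rewrite conjCi [LHS]scalerDr !scalerA mulNr mulrNN -expr2 sqrCi opprK.
    by rewrite scale1r scaleN1r.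
  rewrite rmorph1 !scale1r addrACA addNr addr0 -mulr2n.
  by rewrite -[z *+ 2]scaler_nat scalerA mulVf ?pnatr_eq0// scale1r.
exact/QZ/Qlin.
Qed.

Lemma positive_linear_star (L : {linear A -> A}) :
  (forall a, positive a -> positive (L a)) ->
  forall a, L (star a) = star (L a).
Proof.
move=> Lpos a.
apply: (@polarization_ind 1 (fun a => L (star a) = star (L a)));
  rewrite ?star1 ?mulr1 ?mul1r//.
- by move=> c x y hx hy; rewrite star_lin !linearP hx hy star_lin.
- move=> s _ _; rewrite star_mull.
  have [|b ->] := Lpos (star s * s); first by exists s.
  by rewrite star_mull.
Qed.

End Polarization.

(** * Heredity of the range, and contractivity of [alpha] *)

Section Correspondence.
Variables (R : realType) (A : cstarAlgType R) (alpha : endomorphism A).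
Implicit Types (a b z : A) (x y : corner alpha).
Local Notation p := (alpha 1).

Let ps : star p = p.
Proof. by rewrite -starhom_star star1. Qed.

Let pp : p * p = p.
Proof. exact: alpha1_idem. Qed.

Let alphaP a : p * alpha a = alpha a.
Proof. by rewrite -starhomM mul1r. Qed.

Let Palpha a : alpha a * p = alpha a.
Proof. by rewrite -starhomM mulr1. Qed.

Let cornerP (x : corner alpha) : p * val x = val x.
Proof. exact: (corner_setP _ _ (valP x)). Qed.

Let star_cornerP (x : corner alpha) : star (val x) * p = star (val x).
Proof. by rewrite -[in LHS]ps -starM cornerP. Qed.

(** Compression by [q = 1 - p] kills the majorant [star s * s + star t * t], which lies in the
    range. Hence [s * q = 0], and [star s * s] lies in the corner. *)
Lemma range_hereditary :
  (forall z, p * z = z -> z * p = z -> range alpha z) ->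
  hereditary (range alpha).
Proof.
move=> hr a c [s ->] [t tE] [b _ bc]; rewrite -bc in tE.
pose q := 1 - p.
have qs : star q = q by rewrite starB star1 ps.
have /star_mulD_eq0 sq : star (s * q) * (s * q) + star (t * q) * (t * q) = 0.
  rewrite !starM qs -!mulrA -mulrDr !mulrA -mulrDl -tE addrC subrK.
  by rewrite /q mulrBr mulr1 Palpha subrr mulr0.
have sp : s * p = s.
  by apply/eqP; rewrite eq_sym -subr_eq0 -{1}[s]mulr1 -mulrBr sq.
apply: hr; last by rewrite -mulrA sp.
by rewrite -{1}ps mulrA -starM sp.
Qed.

(** By polarization it suffices to treat [star s * s] in the corner; it lies below
    [alpha (t *: 1) = t *: p] once [t] exceeds its norm. *)
Lemma hereditary_range : hereditary (range alpha) ->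
  forall z, p * z = z -> z * p = z -> range alpha z.
Proof.
move=> her; apply: polarization_ind => //.
  move=> c _ _ [a _ <-] [b _ <-]; exists (c *: a + b) => //.
  by rewrite linearP.
move=> s _ sp; pose t := `|star s * s| + 1; pose h := t *: (1 : A) - star s * s.
have t0 : 0 < t by rewrite ltr_wpDl.
have [|r [rs rE _ rC]] := @nneg_sqrt R A h.
  split; first by rewrite starB star_mull starZ_ge0 ?(ltW t0)// star1.
  by exists t => //; rewrite opprB addrC subrK lerDl.
have pss : p * (star s * s) = star s * s by rewrite mulrA -{1}ps -starM sp.
have ph : p * h = h * p.
  rewrite mulrBr mulrBl -!cstar_scalerAr -!cstar_scalerAl mulr1 mul1r.
  by rewrite pss -mulrA sp.
apply: (her _ (alpha (t *: (1 : A)))); first by exists s.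
  (* The root [r] of [h] commutes with [p], so [p * r] is a self-adjoint root of
     [h * p = t *: p - star s * s]. *)
  exists (p * r); rewrite starM rs ps -mulrA [p * (p * r)]mulrA pp.
  rewrite mulrA -[r * p]rC// -mulrA rE ph /h mulrBl -cstar_scalerAl mul1r.
  by rewrite linearZ -mulrA sp.
by exists (t *: (1 : A)).
Qed.

(** [alpha] maps [b^2 + s^2 = |b|^2] to the same relation with [p] in place of [1], to which
    [cartesian_norm] applies. *)
Lemma norm_starhom_le b : star b = b -> `|alpha b| <= `|b|.
Proof.
move=> bs; have [s [ss sE _ sC]] := nneg_sqrt (nneg_norm_sub_sqr bs).
have bsC : b * s = s * b.
  apply: sC; rewrite mulrBr mulrBl -cstar_scalerAr -cstar_scalerAl.
  by rewrite mulr1 mul1r mulrA.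
rewrite -(@ler_pXn2r _ 2) ?nnegrE//.
rewrite (le_trans (@cartesian_norm _ _ (alpha b) (alpha s) _ _ _))//.
- by rewrite -starhom_star bs.
- by rewrite -starhom_star ss.
- by rewrite -!starhomM bsC.
rewrite -!starhomM -raddfD/= sE addrC subrK linearZ normrZ.
by rewrite ger0_norm ?exprn_ge0// ler_piMr ?exprn_ge0// norm_proj.
Qed.

(** * From a left inner product to the complete transfer operator *)

Section FromBimodule.
Variable lip : corner alpha -> corner alpha -> A.
Hypothesis bimod : hilbert_bimodule (@corner_lact R A alpha)
  (@corner_ract R A alpha) lip (@corner_rip R A alpha).

Let leftE := bimod_left bimod.

Lemma alpha_lip x y : alpha (lip x y) = val x * star (val y).
Proof.
have /(congr1 val) := bimod_imprimitivity bimod x y (corner_one alpha).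
by rewrite /= /corner_rip /= star_cornerP Palpha => <-.
Qed.

Lemma bimodule_complete : admits_complete_transfer_operator alpha.
Proof.
have rangeP z : p * z = z -> z * p = z -> range alpha z.
  move=> pz zp; exists (lip (corner_elt alpha z) (corner_one alpha)) => //.
  by rewrite alpha_lip /= ps pz zp.
split; last exact: range_hereditary.
pose f := lip (corner_one alpha) (corner_one alpha).
have fs : star f = f by exact: (lip_star leftE).
(* The kernel acts by zero on the module, so left linearity of [lip] gives [a * f = 0]; adjoints
   later give [f * a = 0]. *)
have kf a : alpha a = 0 -> a * f = 0.
  move=> a0; rewrite -(lip_act leftE).
  have -> : corner_lact a (corner_one alpha) = 0 *: corner_one alpha.
    by rewrite scale0r; apply: val_inj; rewrite /= a0 mul0r.
  by rewrite (lip_scale leftE) scale0r.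
exists (1 - f).
  by rewrite /= raddfB /= alpha_lip /= ps pp subrr.
move=> a a0; split; last by rewrite mulrBr mulr1 kf// subr0.
rewrite mulrBl mul1r -[f * a](@starK R A) starM fs kf ?star0 ?subr0//.
by rewrite starhom_star (a0 : alpha a = 0) star0.
Qed.

(** The transfer identity gives [L (alpha (lip x y)) = lip x y * L 1]. The factor [L 1] moves to
    [y], where it acts as [alpha (L 1) = p], hence trivially. *)
Lemma transfer_bimodule L : complete_transfer_operator alpha L ->
  (forall x y, lip x y = L (val x * star (val y))) /\
  (forall a, L a = lip (corner_elt alpha a) (corner_one alpha)).
Proof.
move=> [_ [_ Lpos Lmul] Lnd].
have Lstar := positive_linear_star Lpos.
have L1s : star (L 1) = L 1 by rewrite -Lstar star1.
have lipE x y : lip x y = L (val x * star (val y)).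
  rewrite -alpha_lip -[alpha _]mulr1 Lmul.
  rewrite -[RHS](@starK R A) starM L1s (lip_star leftE) -(lip_act leftE).
  have -> : corner_lact (L 1) y = y by apply: val_inj; rewrite /= Lnd cornerP.
  by rewrite (lip_star leftE).
(* It remains to see [L (p * a * p) = L a]: the left [p] goes by the transfer identity, the right
   one after taking adjoints. *)
split=> // a; rewrite lipE /= ps -mulrA Lmul mul1r.
have -> : a * p = star (p * star a) by rewrite starM starK ps.
by rewrite Lstar Lmul mul1r Lstar starK.
Qed.

End FromBimodule.

(** * From a unital kernel and a full corner to a left inner product *)

Section FromTransfer.
Variable e : A.
Hypotheses (ker_e : alpha e = 0)
  (e_unit : forall a, alpha a = 0 -> e * a = a /\ a * e = a).
Hypothesis rangeP : forall z, p * z = z -> z * p = z -> range alpha z.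

Let es : star e = e.
Proof.
have se0 : alpha (star e) = 0 by rewrite starhom_star ker_e star0.
have [eseE _] := e_unit se0.
by rewrite -[RHS](@starK R A) -[in RHS]eseE starM starK eseE.
Qed.

Let ee : e * e = e.
Proof. by have [] := e_unit ker_e. Qed.

(** Both [a * e] and [e * a] lie in the kernel, so each equals [e * a * e]. *)
Let eC a : a * e = e * a.
Proof.
have [|<- _] := @e_unit (a * e); first by rewrite starhomM ker_e mulr0.
have [|_ aeE] := @e_unit (e * a); first by rewrite starhomM ker_e mul0r.
by rewrite mulrA aeE.
Qed.

(* The condition [e * a = 0] says that [a] lies in the annihilator of the
   kernel, on which [alpha] is injective. *)
Let annih_inj a b : e * a = 0 -> e * b = 0 -> alpha a = alpha b -> a = b.
Proof.
move=> ea eb ab; apply/eqP; rewrite -subr_eq0; apply/eqP.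
have [|<- _] := @e_unit (a - b); first by rewrite raddfB /= ab subrr.
by rewrite mulrBr ea eb subrr.
Qed.

Let annih_preimage z : p * z = z -> z * p = z ->
  exists2 b, alpha b = z & e * b = 0.
Proof.
move=> pz zp; have [b _ bz] := rangeP pz zp; exists (b - e * b).
  by rewrite raddfB /= starhomM ker_e mul0r subr0.
by rewrite mulrBr mulrA ee subrr.
Qed.

Let annih_star a : e * a = 0 -> e * star a = 0.
Proof. by move=> ea; rewrite -[LHS](@starK R A) starM starK es eC ea star0. Qed.

Let annih_mull a b : e * b = 0 -> e * (a * b) = 0.
Proof. by move=> eb; rewrite mulrA -eC -mulrA eb mulr0. Qed.

Let preimage_sa z : star z = z -> p * z = z ->
  exists b, [/\ alpha b = z, e * b = 0 & star b = b].
Proof.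
move=> zs pz; have zp : z * p = z by rewrite -{1}zs -ps -starM pz zs.
have [b bz eb] := annih_preimage pz zp; exists b; split=> //.
by apply: annih_inj; rewrite ?annih_star// starhom_star bz.
Qed.

(* Apply [cartesian_norm] to [b] and a preimage of a square root of
   [`|alpha b| ^+ 2 - alpha b * alpha b]. *)
Lemma norm_annih_le b : star b = b -> e * b = 0 -> `|b| <= `|alpha b|.
Proof.
move=> bs eb; pose d := alpha b.
have ds : star d = d by rewrite -starhom_star bs.
have [s [ss sE _ sC]] := nneg_sqrt (nneg_norm_sub_sqr ds).
have C (x : A) : x * d = d * x -> x * s = s * x.
  move=> xd; apply: sC; rewrite mulrBr mulrBl -cstar_scalerAr -cstar_scalerAl.
  by rewrite mulr1 mul1r mulrA xd -mulrA xd mulrA.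
have psC : p * s = s * p by apply: C; rewrite alphaP Palpha.
(* [s] need not lie in the corner, but [p * s] does, and it is self-adjoint since [s] commutes with
   [p]. *)
have [c [cE ec cs]] : exists c, [/\ alpha c = p * s, e * c = 0 & star c = c].
  apply: preimage_sa; last by rewrite mulrA pp.
  by rewrite starM ps ss psC.
(* [1 - e] is the preimage of [p] in the annihilator, so both sides have the image
   [|d| ^+ 2 *: p]. *)
have bcE : b * b + c * c = `|d| ^+ 2 *: (1 - e).
  apply: annih_inj; first by rewrite mulrDr !annih_mull// addr0.
    by rewrite -cstar_scalerAr mulrBr mulr1 ee subrr scaler0.
  rewrite raddfD/= !starhomM cE linearZ raddfB/= ker_e subr0 -/d.
  rewrite mulrA -[p * s * p]mulrA -psC mulrA pp -mulrA sE mulrBr.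
  by rewrite -cstar_scalerAr mulr1 mulrA alphaP addrC subrK.
have bcC : b * c = c * b.
  apply: annih_inj; rewrite ?annih_mull// !starhomM cE -/d.
  by rewrite mulrA Palpha -mulrA -(C d)// mulrA alphaP.
rewrite -(@ler_pXn2r _ 2) ?nnegrE// (le_trans (cartesian_norm bs cs bcC))//.
rewrite bcE normrZ ger0_norm ?exprn_ge0// ler_piMr ?exprn_ge0// norm_proj//.
  by rewrite starB star1 es.
by rewrite mulrBl mul1r mulrBr mulr1 ee subrr subr0.
Qed.

Lemma exists_bimodule : exists lip, hilbert_bimodule (@corner_lact R A alpha)
  (@corner_ract R A alpha) lip (@corner_rip R A alpha).
Proof.
have /choice[g gP] (xy : corner alpha * corner alpha) :
    exists b, alpha b = val xy.1 * star (val xy.2) /\ e * b = 0.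
  have [||b] := @annih_preimage (val xy.1 * star (val xy.2)); last by exists b.
    by rewrite mulrA cornerP.
  by rewrite -mulrA star_cornerP.
pose lip x y := g (x, y).
have lipE x y : alpha (lip x y) = val x * star (val y) by have [] := gP (x, y).
have elip x y : e * lip x y = 0 by have [] := gP (x, y).
have lip_star x y : star (lip x y) = lip y x.
  by apply: annih_inj; rewrite ?annih_star// starhom_star !lipE starM starK.
exists lip; split.
- split.
  + by move=> a b x; apply: val_inj; rewrite /= raddfD mulrDl.
  + by move=> a x y; apply: val_inj; rewrite /= mulrDr.
  + by move=> c a x; apply: val_inj; rewrite /= linearZ cstar_scalerAl.
  + by move=> c a x; apply: val_inj; rewrite /= cstar_scalerAr.
  + by move=> a b x; apply: val_inj; rewrite /= starhomM mulrA.
  + move=> x y z; apply: annih_inj; rewrite ?mulrDr ?elip ?addr0//.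
    by rewrite raddfD /= !lipE mulrDl.
  + move=> c x y; apply: annih_inj; rewrite -?cstar_scalerAr ?elip ?scaler0//.
    by rewrite linearZ /= !lipE cstar_scalerAl.
  + move=> a x y; apply: annih_inj; rewrite ?annih_mull//.
    by rewrite starhomM !lipE mulrA.
  + exact: lip_star.
  (* A root [r] of [val x * star (val x)] commutes with [p]; the self-adjoint annihilator preimage
     [c] of [p * r] satisfies [c * c = lip x x]. *)
  + move=> x; have := @nneg_star_mul R A (star (val x)); rewrite starK.
    move=> /nneg_sqrt[r [rs rE _ rC]].
    have pr : p * r = r * p.
      by apply: rC; rewrite mulrA cornerP -mulrA star_cornerP.
    have [c [cE ec cs]] :
        exists c, [/\ alpha c = p * r, e * c = 0 & star c = c].
      apply: preimage_sa; last by rewrite mulrA pp.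
      by rewrite starM ps rs pr.
    exists c; rewrite cs; apply: annih_inj; rewrite ?annih_mull//.
    rewrite lipE starhomM cE mulrA -[p * r * p]mulrA -pr mulrA pp -mulrA rE.
    by rewrite mulrA cornerP.
  + move=> x x0; apply: val_inj; apply: normr0_eq0; apply/eqP.
    rewrite -sqrf_eq0 -norm_mul_star -lipE x0 raddf0 normr0//.
  (* The two norm comparisons make [alpha] isometric on self-adjoint elements of the annihilator,
     such as [lip x x]. *)
  + move=> x; rewrite -norm_mul_star -lipE; apply/le_anti.
    by rewrite norm_starhom_le ?norm_annih_le.
- split.
  + by move=> x y a; apply: val_inj; rewrite /= mulrDl.
  + by move=> x a b; apply: val_inj; rewrite /= mulrDr.
  + by move=> c x a; apply: val_inj; rewrite /= cstar_scalerAl.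
  + by move=> c x a; apply: val_inj; rewrite /= cstar_scalerAr.
  + by move=> x a b; apply: val_inj; rewrite /= mulrA.
  + by move=> x y z; rewrite /corner_rip mulrDr.
  + by move=> c x y; rewrite /corner_rip cstar_scalerAr.
  + by move=> x y a; rewrite /corner_rip /= mulrA.
  + by move=> x y; rewrite /corner_rip starM starK.
  + by move=> x; exists (val x).
  + by move=> x /cstar_eq0 x0; apply: val_inj.
  + by move=> x; rewrite /corner_rip cstar_normE.
- by move=> x y z; apply: val_inj; rewrite /= lipE mulrA.
Qed.

End FromTransfer.

End Correspondence.

Theorem proposition1p9 (R : realType) (A : cstarAlgType R)
    (alpha : endomorphism A) :
  ((exists lip : corner alpha -> corner alpha -> A,
      hilbert_bimodule (@corner_lact R A alpha) (@corner_ract R A alpha)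
        lip (@corner_rip R A alpha))
   <-> admits_complete_transfer_operator alpha)
  /\
  (forall L : {linear A -> A}, complete_transfer_operator alpha L ->
   forall lip : corner alpha -> corner alpha -> A,
      hilbert_bimodule (@corner_lact R A alpha) (@corner_ract R A alpha)
        lip (@corner_rip R A alpha) ->
      (forall x y : corner alpha, lip x y = L (val x * star (val y))) /\
      (forall a : A, L a = lip (corner_elt alpha a) (corner_one alpha))).
Proof.
split; last by move=> L hL lip bimod; exact: transfer_bimodule.
split=> [[lip bimod]|[[e ker_e e_unit] her]].
  exact: bimodule_complete bimod.
exact: exists_bimodule ker_e e_unit (hereditary_range her).
Qed.
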